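(* For the deterministic inventory model and the ordering policy $(\mathbf t,\mathbf y)$ described in the context, the average occupation measures $\{m_{0,t}\}$ are tight as $t\to\infty$; that is, for each $\epsilon>0$ there exist a compact set $\Gamma\subset\mathbb R_+$ and $T<\infty$ such that $m_{0,t}(\Gamma^c)<\epsilon$ for all $t\ge T$.
   Context: Model. An ordering policy $(\mathbf t,\mathbf y)$ is a sequence of order times $t_k$ and nonnegative order sizes $y_k$, and the inventory process is $x(t)=-t+\sum_kI_{\{t_k\le t\}}y_k$ (initial level $0$ before any order; demand rate $1$). For $t>0$ the average occupation measure is $$m_{0,t}(\Gamma_0)=\frac1t\int_0^tI_{\Gamma_0}(x(s))\,ds,\qquad \Gamma_0\in\mathcal B(\mathbb R).$$ Policy. Orders are indexed by pairs $(i,j)$: cycle $i=1,2,3,\dots$ and order number $j=1,\dots,2^i+1$ within cycle $i$ (listed lexicographically this gives the single-index sequence). Set $t_{1,1}=0$ and, for $i\ge2$, $t_{i,1}=t_{i-1,2^{i-1}+1}+2^{(i-2)/2}$. For each $i\ge1$: Phase 1: $y_{i,1}=1$, and $t_{i,j}=t_{i,j-1}+1$, $y_{i,j}=1$ for $j=2,\dots,2^{i-1}$. Phase 2: $t_{i,2^{i-1}+1}=t_{i,2^{i-1}}+1$, $y_{i,2^{i-1}+1}=2^{(i-1)/2}$; and $t_{i,2^{i-1}+1+j}=t_{i,2^{i-1}+1}$, $y_{i,2^{i-1}+1+j}=0$ for $j=1,\dots,2^{i-1}$. Thus each nonzero order is placed when the level hits $0$; cycle $i$ ends when $x$ hits $0$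 at time $t_{i+1,1}$. *)

(* Defs.v *)
From HB Require Import structures.
From mathcomp Require Import all_boot all_order all_algebra.
From mathcomp Require Import all_classical all_reals all_analysis.
Set Implicit Arguments.
Unset Strict Implicit.
Unset Printing Implicit Defensive.
Import Order.TTheory GRing.Theory Num.Theory.
Import numFieldNormedType.Exports.
Local Open Scope classical_set_scope.
Local Open Scope ring_scope.

Record ordering_policy (R : realType) := OrderingPolicy {
  order_time : nat -> R ;
  order_size : nat -> R ;
  order_size_ge0 : forall k, 0 <= order_size k }.

(* If infinitely many orders before [t] have a divergent total size, the
   limit is a junk value; a policy placing finitely many orders in each bounded
   time interval never meets this case. *)
Definition inventory (R : realType) (p : ordering_policy R) (t : R) : R :=
  - t + limn (series (fun k =>
                 if order_time p k <= t then order_size p k else 0)).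

Definition occupation_measure (R : realType) (x : R -> R) (t : R)
    (G : set R) : \bar R :=
  ((t^-1)%:E * \int[lebesgue_measure]_(s in `[0%R, t]) (\1_G (x s))%:E)%E.

(* [m t] is only meaningful for [0 < t]. *)
Definition tight_at_infinity (R : realType) (m : R -> set R -> \bar R) : Prop :=
  forall eps : R, 0 < eps ->
    exists G : set R, exists T : R,
      [/\ compact G, G `<=` [set x | 0 <= x] &
          forall t : R, 0 < t -> T <= t -> (m t (~` G) < eps%:E)%E].

(* Cycles are numbered i = 1, 2, ... and the orders of cycle i are numbered
   j = 1, ..., 2 ^ i + 1; values outside these ranges are irrelevant. *)

Definition cycle_order_size (R : realType) (i j : nat) : R :=
  if (j <= 2 ^ i.-1)%N then 1
  else if j == (2 ^ i.-1).+1 then 2 `^ ((i%:R - 1) / 2)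
  else 0.

(* Orders 2, ..., 2 ^ (i - 1) + 1 of cycle i are placed one unit of time after
   their predecessor, the later ones at the same time as their predecessor. *)
Fixpoint cycle_order_time_from (R : realType) (start : R) (i j : nat) : R :=
  match j with
  | j'.+1 => if j' is 0 then start
             else if (j'.+1 <= (2 ^ i.-1).+1)%N
             then cycle_order_time_from start i j' + 1
             else cycle_order_time_from start i j'
  | 0 => start
  end.

Fixpoint cycle_start (R : realType) (i : nat) : R :=
  match i with
  | i'.+1 => if i' is 0 then 0
             else cycle_order_time_from (cycle_start R i') i' (2 ^ i').+1
                  + 2 `^ ((i'.+1%:R - 2) / 2)
  | 0 => 0
  end.

Definition cycle_order_time (R : realType) (i j : nat) : R :=
  cycle_order_time_from (cycle_start R i) i j.

(* Lexicographic enumeration of the pairs (i, j), 1 <= i, 1 <= j <= 2 ^ i + 1. *)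
Definition next_order (ij : nat * nat) : nat * nat :=
  if (ij.2 < (2 ^ ij.1).+1)%N then (ij.1, ij.2.+1) else (ij.1.+1, 1%N).

Definition order_index (k : nat) : nat * nat := iter k next_order (1%N, 1%N).

Lemma cycle_order_size_ge0 (R : realType) (i j : nat) :
  0 <= cycle_order_size R i j.
Proof.
by rewrite /cycle_order_size; case: ifP => // _; case: ifP => // _; exact: powR_ge0.
Qed.

Definition cycle_policy (R : realType) : ordering_policy R :=
  @OrderingPolicy R
    (fun k => cycle_order_time R (order_index k).1 (order_index k).2)
    (fun k => cycle_order_size R (order_index k).1 (order_index k).2)
    (fun k => cycle_order_size_ge0 R (order_index k).1 (order_index k).2).

Lemma cycle_order_time11 (R : realType) : cycle_order_time R 1 1 = 0.
Proof. by []. Qed.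

Lemma cycle_order_timeS1 (R : realType) (i : nat) : (2 <= i)%N ->
  cycle_order_time R i 1 =
  cycle_order_time R i.-1 (2 ^ i.-1).+1 + 2 `^ ((i%:R - 2) / 2).
Proof. by case: i => [|[|i]]. Qed.

Lemma cycle_order_time_phase1 (R : realType) (i j : nat) :
  (2 <= j <= 2 ^ i.-1)%N ->
  cycle_order_time R i j = cycle_order_time R i j.-1 + 1.
Proof.
case: j => [|[|j]] // /andP[_ ji].
by rewrite {1}/cycle_order_time /= ltnS (ltnW ji).
Qed.

Lemma cycle_order_time_phase2 (R : realType) (i : nat) : (1 <= i)%N ->
  cycle_order_time R i (2 ^ i.-1).+1 =
  cycle_order_time R i (2 ^ i.-1) + 1.
Proof.
move=> _; rewrite {1}/cycle_order_time /=.
case E : (2 ^ i.-1)%N => [|n]; first by have := expn_gt0 2 i.-1; rewrite E.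
by rewrite leqnn.
Qed.

Lemma cycle_order_time_phase2_zero (R : realType) (i j : nat) :
  (1 <= j <= 2 ^ i.-1)%N ->
  cycle_order_time R i ((2 ^ i.-1).+1 + j) =
  cycle_order_time R i (2 ^ i.-1).+1.
Proof.
move=> _; elim: j => [|j IH]; first by rewrite addn0.
rewrite -IH addnS {1}/cycle_order_time /= !addSn.
by rewrite ltnS ltnNge leq_addr.
Qed.

Lemma order_index_surj (i j : nat) : (1 <= i)%N -> (1 <= j <= (2 ^ i).+1)%N ->
  exists k, order_index k = (i, j).
Proof.
case: i => // i _.
have step n m k : order_index k = (n, 1%N) -> (m < (2 ^ n).+1)%N ->
    order_index (m + k) = (n, m.+1).
  move=> kn; elim: m => [|m IH] // mn.
  by rewrite addSn /order_index iterS -/(order_index _) IH ?(ltnW mn)//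
    /next_order /= mn.
have start n : exists k, order_index k = (n.+1, 1%N).
  elim: n => [|n [k kn]]; first by exists 0%N.
  exists (2 ^ n.+1 + k).+1.
  by rewrite /order_index iterS -/(order_index _) (step _ _ _ kn)//
    /next_order /= ltnn.
have [k kn] := start i; case: j => // j /= ji.
by exists (j + k)%N; exact: step.
Qed.

(* Main.v *)
(* The level stays in [0, 1] during every phase 1, which lasts 2 ^ (i - 1) in
   cycle i, while phase 2 only lasts sqrt 2 ^ (i - 1). Hence, up to a time t in
   cycle i, the level has left [0, 1] for a total time of order sqrt 2 ^ i, that
   is, at most of order sqrt t, and the compact set [0, 1] works for every eps. *)
Require Import Defs.
From mathcomp Require Import all_boot all_order all_algebra.
From mathcomp Require Import all_classical all_reals all_analysis.
From mathcomp Require Import zify ring lra.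
Set Implicit Arguments.
Unset Strict Implicit.
Unset Printing Implicit Defensive.
Import Order.TTheory GRing.Theory Num.Theory.
Import numFieldNormedType.Exports.
Local Open Scope classical_set_scope.
Local Open Scope ring_scope.

(* [A] need not be measurable, which spares the measurability of the inventory
   process. *)
Lemma le_integral_indic d (T : measurableType d) (R : realType)
    (mu : {measure set T -> \bar R}) (D A B : set T) :
  measurable D -> measurable B -> (forall x, D x -> A x -> B x) ->
  (\int[mu]_(x in D) (\1_A x)%:E <= mu (B `&` D))%E.
Proof.
move=> mD mB AB; rewrite -integral_indic// !(integral_mkcond D).
have indic0 (C : set T) x : (0 <= ((fun x => (\1_C x)%:E) \_ D) x :> \bar R)%E.
  by apply: erestrict_ge0 => y _; rewrite lee_fin.
rewrite !ge0_integralTE//; apply: ereal_sup_le => _ /= [h hA <-].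
exists h => // x; apply: (le_trans (hA x)); rewrite /patch.
case: ifPn => // /set_mem Dx; rewrite lee_fin !indicE.
by have [/set_mem /(AB _ Dx) Bx|_] := boolP (x \in A); rewrite ?(mem_set Bx) ?ler0n.
Qed.

(** Monotone times make every term of index above [k] vanish, so the partial sums are eventually
    constant and [limn] takes that constant value. The strict bound on the right makes [k] the last
    of any simultaneous orders. *)
Lemma inventoryE (R : realType) (p : ordering_policy R) (k : nat) (t : R) :
  nondecreasing_seq (order_time p) ->
  order_time p k <= t < order_time p k.+1 ->
  inventory p t = - t + series (order_size p) k.+1.
Proof.
move=> ptime /andP[kt tk]; congr (_ + _); apply: lim_near_cst => //.
exists k.+1 => // m /= km; rewrite /series /=.
rewrite (@big_cat_nat _ _ _ k.+1)//= [X in _ + X = _]big_nat_cond [X in _ + X = _]big1 ?addr0.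
  rewrite [LHS]big_nat_cond [RHS]big_nat_cond; apply: eq_bigr => i /andP[/andP[_ ik] _].
  by rewrite (le_trans (ptime _ _ _) kt).
move=> i /andP[/andP[ki _] _]; rewrite ifF//; apply/negbTE.
by rewrite -ltNge (lt_le_trans tk)// ptime.
Qed.

Lemma lt_nat_expn2 (R : realType) (t : R) : exists n, t < (2 ^ n)%:R.
Proof.
exists (Num.bound `|t|); apply: le_lt_trans (ler_norm t) _.
by apply: lt_le_trans (archi_boundP _) _; rewrite // ler_nat ltnW// ltn_expl.
Qed.

Lemma order_indexS (k n j : nat) : order_index k = (n.+1, j.+1) ->
  order_index k.+1 = if (j < 2 ^ n.+1)%N then (n.+1, j.+2) else (n.+2, 1%N).
Proof.
by move=> kE; rewrite -[LHS]/(next_order (order_index k)) kE /next_order /= ltnS.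
Qed.

Section cycle_policy.
Variable R : realType.

(** * Powers of sqrt 2, written [a], and the starting times of the cycles *)

Local Notation a := (2 `^ 2^-1 : R).
Local Notation S := (cycle_start R).
Local Notation tau := (order_time (cycle_policy R)).
Local Notation y := (order_size (cycle_policy R)).

Lemma sqr_powR2_half : a * a = 2.
Proof.
rewrite -powRD ?pnatr_eq0 ?implybT//.
by rewrite (_ : 2^-1 + 2^-1 = 1); [rewrite powRr1|field].
Qed.

(** The constant 5/4 is what the induction in [sum_powR2_half_expr] needs, namely 4 + 1 <= 4 * a. *)
Lemma powR2_half_ge : 5 / 4 <= a.
Proof. have := sqr_powR2_half; have := powR_ge0 (2 : R) 2^-1; nra. Qed.

Lemma powR2_half_natmul (n : nat) : 2 `^ (n%:R / 2) = a ^+ n.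
Proof. by rewrite mulrC powRrM powR_mulrn// powR_ge0. Qed.

(** The cap at [2 ^ n] reflects that the empty orders share the time of the large order of phase
    2. *)
Lemma cycle_order_timeE (n j : nat) :
  cycle_order_time R n.+1 j.+1 = S n.+1 + (minn j (2 ^ n))%:R.
Proof.
elim: j => [|j IH]; first by rewrite min0n addr0.
rewrite /cycle_order_time -[LHS]/(if (j.+2 <= (2 ^ n).+1)%N
  then cycle_order_time R n.+1 j.+1 + 1 else cycle_order_time R n.+1 j.+1) IH.
case: ifPn => jn; last by congr (_ + _%:R); lia.
by rewrite -addrA natr1; congr (_ + _%:R); lia.
Qed.

Lemma cycle_startS (n : nat) : S n.+2 = S n.+1 + (2 ^ n)%:R + a ^+ n.
Proof.
rewrite -[LHS]/(cycle_order_time R n.+1 (2 ^ n.+1).+1 + 2 `^ ((n.+2%:R - 2) / 2)).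
rewrite cycle_order_timeE -powR2_half_natmul; congr (_ + _%:R + _ `^ (_ / 2)).
  by rewrite expnS; lia.
by rewrite -natrB// subSS subSS subn0.
Qed.

Lemma powR2_half_expr_ge0 (n : nat) : 0 <= a ^+ n.
Proof. by rewrite exprn_ge0// powR_ge0. Qed.

Lemma nondecreasing_cycle_start : nondecreasing_seq S.
Proof.
apply/nondecreasing_seqP => -[|n]; first by [].
by rewrite cycle_startS -addrA lerDl addr_ge0// powR2_half_expr_ge0.
Qed.

(** The earlier phases 1 alone last 1 + 2 + ... + 2^(n-1) = 2^n - 1; the phases 2 are discarded. *)
Lemma cycle_start_lower_bound (n : nat) : (2 ^ n)%:R <= S n.+1 + 1.
Proof.
elim: n => [|n IH]; first by rewrite add0r.
rewrite cycle_startS expnS natrM; have := powR2_half_expr_ge0 n; lra.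
Qed.

(** Allows the final estimate to replace [t + 1] by [2 * t]. *)
Lemma cycle_startSS_ge1 (n : nat) : 1 <= S n.+2.
Proof.
rewrite -(lerD2r 1); apply: le_trans (cycle_start_lower_bound n.+1).
by rewrite (_ : 1 + 1 = 2%:R)// ler_nat expnS leq_pmulr// expn_gt0.
Qed.

Lemma lt_cycle_start (t : R) : exists n, t < S n.+1.
Proof.
have [n tn] := lt_nat_expn2 (t + 1).
exists n; rewrite -(ltrD2r 1); exact: lt_le_trans tn (cycle_start_lower_bound n).
Qed.

Lemma cycle_start_between (t : R) : 0 <= t -> exists n, S n.+1 <= t < S n.+2.
Proof.
move=> t0; have [[|n] tn nmin] := ex_minnP (lt_cycle_start t).
  by move: tn; rewrite ltNge t0.
by exists n; rewrite tn andbT leNgt; apply/negP => /nmin; rewrite ltnn.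
Qed.

(** * Orders in the lexicographic enumeration, and the resulting level *)

Lemma order_size_phase1 (n j : nat) : (j < 2 ^ n)%N ->
  cycle_order_size R n.+1 j.+1 = 1.
Proof. by rewrite /cycle_order_size /= => ->. Qed.

Lemma order_size_phase2 (n : nat) : cycle_order_size R n.+1 (2 ^ n).+1 = a ^+ n.
Proof.
by rewrite /cycle_order_size /= ltnn eqxx -powR2_half_natmul -(natr1 n) addrK.
Qed.

Lemma order_size_phase2_zero (n j : nat) : (2 ^ n < j)%N ->
  cycle_order_size R n.+1 j.+1 = 0.
Proof. by move=> nj; rewrite /cycle_order_size /= ltnNge ltnW//= eqSS gtn_eqF. Qed.

(* The total size of the orders before order [k] is the time at which the level
   they produce reaches 0. *)
Lemma order_index_series (k : nat) : exists n j,
  [/\ order_index k = (n.+1, j.+1), (j <= 2 ^ n.+1)%N &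
      series y k = if (j <= 2 ^ n)%N then S n.+1 + j%:R else S n.+2].
Proof.
elim: k => [|k [n [j [kE jn yk]]]].
  by exists 0%N, 0%N; split => //; rewrite /series /= big_nil addr0.
have ySk : series y k.+1 = series y k + cycle_order_size R n.+1 j.+1.
  by rewrite seriesSr/= kE addrC.
rewrite ySk yk (order_indexS kE); case: ifPn => jn'; last first.
  (* The enumeration passes to the next cycle; the order just added is empty because
     [2 ^ n < 2 ^ n.+1], so the total is unchanged. *)
  exists n.+1, 0%N; split => //; rewrite addr0.
  have -> : j = (2 ^ n.+1)%N by lia.
  have n2 : (2 ^ n < 2 ^ n.+1)%N by rewrite ltn_exp2l.
  by rewrite leqNgt n2/= order_size_phase2_zero// addr0.
exists n, j.+1; split => //; case: (ltngtP j (2 ^ n)%N) => [jlt|jgt|->].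
- by rewrite order_size_phase1// -addrA natr1.
- by rewrite order_size_phase2_zero// addr0.
- by rewrite order_size_phase2 cycle_startS.
Qed.

Lemma order_timeE (k n j : nat) : order_index k = (n.+1, j.+1) ->
  tau k = S n.+1 + (minn j (2 ^ n))%:R.
Proof. by move=> kE; rewrite /= kE cycle_order_timeE. Qed.

Lemma nondecreasing_order_time : nondecreasing_seq tau.
Proof.
apply/nondecreasing_seqP => k; have [n [j [kE jn _]]] := order_index_series k.
move: (order_indexS kE); case: ifPn => _ /order_timeE ->; rewrite (order_timeE kE).
  by rewrite lerD2l ler_nat; lia.
rewrite min0n addr0 cycle_startS -addrA lerD2l.
by rewrite ler_wpDr ?powR2_half_expr_ge0// ler_nat geq_minr.
Qed.

Lemma order_time_between (s : R) : 0 <= s -> exists k, tau k <= s < tau k.+1.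
Proof.
move=> s0; have : exists k, s < tau k.
  have [n sn] := lt_cycle_start s.
  have [//|k kE] := @order_index_surj n.+1 1 isT.
  by exists k; rewrite (order_timeE kE) min0n addr0.
move=> /ex_minnP[[|k] sk kmin]; first by move: sk; rewrite ltNge s0.
by exists k; rewrite sk andbT leNgt; apply/negP => /kmin; rewrite ltnn.
Qed.

(** In phase 1 a unit order meets one unit of demand. In phase 2 only the time window matters, so
    the level itself is left unestimated. *)
Lemma inventory_cycle_policy_bounds (s : R) : 0 <= s ->
  0 <= inventory (cycle_policy R) s <= 1 \/
  exists n, S n.+1 + (2 ^ n)%:R <= s <= S n.+2.
Proof.
move=> /order_time_between[k ks]; have /andP[k_le_s s_lt_k] := ks.
rewrite (inventoryE nondecreasing_order_time ks).
have [n [j [kE jn yk]]] := order_index_series k.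
have [jlt|nj] := ltnP j (2 ^ n)%N.
  left; rewrite seriesSr /= kE /= order_size_phase1// yk (ltnW jlt).
  have kSE : order_index k.+1 = (n.+1, j.+2).
    by rewrite (order_indexS kE) ifT// (leq_trans jlt)// leq_exp2l.
  move: k_le_s s_lt_k; rewrite (order_timeE kE) (order_timeE kSE).
  rewrite (minn_idPl (ltnW jlt)) (minn_idPl jlt) -natr1; lra.
(* Order [k] is the large order or an empty one, all placed when phase 2 begins; the next order is
   simultaneous or opens the next cycle. *)
right; exists n; move: k_le_s; rewrite (order_timeE kE) (minn_idPr nj) => ->; rewrite andTb.
apply: le_trans (ltW s_lt_k) _.
move: (order_indexS kE); case: ifPn => _ /order_timeE ->; last by rewrite min0n addr0.
by rewrite cycle_startS -addrA lerD2l ler_wpDr ?powR2_half_expr_ge0// ler_nat geq_minr.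
Qed.

(** * Time spent outside [0, 1] *)

Lemma sum_powR2_half_expr (n : nat) : \sum_(l < n) a ^+ l <= 4 * a ^+ n.
Proof.
elim: n => [|n IH]; first by rewrite big_ord0.
rewrite big_ord_recr/= exprS.
have := powR2_half_ge; have := powR2_half_expr_ge0 n; nra.
Qed.

Lemma integral_inventory_gt1 (n : nat) (t : R) : t < S n.+1 ->
  (\int[lebesgue_measure]_(s in `[0%R, t])
     (\1_(~` `[0%R, 1%R]) (inventory (cycle_policy R) s))%:E <=
   (4 * a ^+ n)%:E)%E.
Proof.
(* [B l] is the phase 2 window of cycle [l.+1], of length [a ^+ l]. The windows meeting [0, t] cover
   the exit times, and Boole's inequality sums their lengths. *)
move=> tn; pose B l : set R := `[S l.+1 + (2 ^ l)%:R, S l.+2]%classic.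
have muB l : (lebesgue_measure (B l) <= (a ^+ l)%:E)%E.
  rewrite /B cycle_startS lebesgue_measure_itv/= lte_fin.
  case: ifPn => _; last by rewrite lee_fin powR2_half_expr_ge0.
  by rewrite -EFinB lee_fin addrC addKr.
have mB : measurable (\big[setU/set0]_(l < n) B l).
  by apply: bigsetU_measurable => l _; exact: measurable_itv.
apply: (@le_trans _ _ (lebesgue_measure (\big[setU/set0]_(l < n) B l : set R))).
  apply: le_trans (@le_integral_indic _ _ _ lebesgue_measure _
    (inventory (cycle_policy R) @^-1` ~` `[0, 1]) _ _ mB _) _ => //.
    move=> s /=; rewrite in_itv/= => /andP[s0 st] xs.
    have [/andP[x0 x1]|[l /andP[ls sl]]] := inventory_cycle_policy_bounds s0.
      by exfalso; apply: xs; rewrite in_itv/= x0.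
    rewrite -bigcup_mkord; exists l; last by rewrite /B /= in_itv/= ls.
    (* A window with [n <= l] would start no earlier than [S n.+1], hence after [t]. *)
    rewrite /= ltnNge; apply/negP => nl.
    have := @nondecreasing_cycle_start n.+1 l.+1 nl.
    have : 0 <= (2 ^ l)%:R :> R by [].
    lra.
  by apply: le_measure; rewrite ?inE//; exact: measurableI.
apply: le_trans (Boole_inequality _ _) _.
  by move=> l _; exact: measurable_itv.
apply: (@le_trans _ _ (\sum_(l < n) (a ^+ l)%:E)%E); last first.
  by rewrite sumEFin lee_fin sum_powR2_half_expr.
by apply: lee_sum => l _; exact: muB.
Qed.

End cycle_policy.

Theorem corollary2p4 (R : realType) :
  tight_at_infinity (occupation_measure (inventory (cycle_policy R))).
Proof.
move=> eps eps0.
have := @integral_inventory_gt1 R; have := sqr_powR2_half R; have := powR2_half_ge R.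
move: (2 `^ 2^-1) => a a_ge a_sqr int_le.
have a1 : 1 < a by lra.
have a_le2 : a <= 2 by nra.
(* 16 is 8 * 2: the factor 8 bounds [4 * a], and 2 comes from 2^n <= t + 1 <= 2 * t. An even
   exponent turns the power of [a] into a power of 2. *)
have [N aN] : exists N, 16 / eps < a ^+ N.
  have [m em] := lt_nat_expn2 (16 / eps).
  by exists (2 * m)%N; rewrite exprM expr2 a_sqr -natrX.
(* With this threshold, the cycle [n.+1] containing [t] satisfies [N < n], hence
   [16 < eps * a ^+ n]. *)
exists `[0, 1]%classic, (cycle_start R N.+2); split.
- exact: segment_compact.
- by move=> x /=; rewrite in_itv/= => /andP[].
move=> t t0 Tt; have [n /andP[nt tn]] := cycle_start_between (ltW t0).
rewrite /occupation_measure.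
apply: (@le_lt_trans _ _ ((t^-1)%:E * (4 * a ^+ n.+1)%:E)%E).
  by rewrite lee_wpmul2l ?lee_fin ?invr_ge0 ?(ltW t0)//; exact: int_le.
rewrite -EFinM lte_fin mulrC ltr_pdivrMr//.
have Nn : (N < n)%N.
  rewrite ltnNge; apply/negP => nN.
  have : cycle_start R n.+2 <= cycle_start R N.+2 by apply: nondecreasing_cycle_start.
  by rewrite leNgt (le_lt_trans Tt tn).
have {}aN : 16 < eps * a ^+ n.
  rewrite mulrC -ltr_pdivrMr//; apply: (lt_le_trans aN).
  by rewrite ler_eXn2l// ltnW.
have t1 := le_trans (cycle_startSS_ge1 R N) Tt.
have := le_trans (cycle_start_lower_bound R n) (lerD nt (lexx 1)).
have : a ^+ n * a ^+ n = (2 ^ n)%:R by rewrite -exprMn a_sqr natrX.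
have : 0 < a ^+ n by rewrite exprn_gt0// (lt_trans ltr01).
rewrite exprS; clear tn nt Tt int_le; move: (a ^+ n) ((2 ^ n)%:R) aN => b c aN b0 bc ct.
(* With b = a^n and c = b^2 = 2^n, the chain is 4ab <= 8b < eps b^2 / 2 = eps c / 2 <= eps t. *)
apply: (@le_lt_trans _ _ (8 * b)); first by nra.
apply: (@lt_le_trans _ _ (eps * c / 2)); last by nra.
by rewrite -bc; nra.
Qed.
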